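(* Let $A$ be a Banach algebra. Then: (1) If $A^{***}A^{**}\subseteq A^*$, then $\tilde{Z}_1^\ell(A^{**})=Z_1(A^{**})=A^{**}$. (2) If $A^{**}A^{***}\subseteq A^*$, then $\tilde{Z}_1^r(A^{**})=A^{**}$.
   Context: $A^*,A^{**},A^{***}$ denote the successive duals of $A$; $A$ is regarded as a subspace of $A^{**}$ and $A^*$ as a subspace of $A^{***}$ via the canonical embeddings. $A^{**}$ carries the first Arens product: for $a,b\in A$, $a'\in A^*$, $a'',b''\in A^{**}$, $\langle a'a,b\rangle=\langle a',ab\rangle$, $\langle a''a',a\rangle=\langle a'',a'a\rangle$, $\langle a''b'',a'\rangle=\langle a'',b''a'\rangle$. For $a'''\in A^{***}$ and $b''\in A^{**}$, the elements $a'''b'',\,b''a'''\in A^{***}$ are defined by $\langle a'''b'',c''\rangle=\langle a''',b''c''\rangle$ and $\langle b''a''',c''\rangle=\langle a''',c''b''\rangle$ for $c''\in A^{**}$. For sets $X,Y$, $XY=\{xy: x\in X,y\in Y\}$. On $A^{**}$, weak$^*$ means $\sigma(A^{**},A^* )$ and weak means $\sigma(A^{**},A^{***})$. $Z_1(A^{**})=\{a''\in A^{**}: b''\mapsto a''b'' \text{ is weak}^*\text{-to-weak}^*\text{ continuous on }A^{**}\}$. $\tilde Z_1^\ell(A^{**})=\{a''\in A^{**}: b''\mapsto a''b'' \text{ is weak}^*\text{-to-weak continuous on }A^{**}\}$. $\tilde Z_1^r(A^{**})=\{a''\in A^{**}: b''\mapsto b''a'' \text{ is weak}^*\text{-to-weak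 continuous on }A^{**}\}$. *)

(* Defs.v *)
From HB Require Import structures.
From mathcomp Require Import all_boot all_order all_algebra.
From mathcomp Require Import complex.
From mathcomp Require Import all_classical all_reals all_analysis.

Set Implicit Arguments.
Unset Strict Implicit.
Unset Printing Implicit Defensive.

Import Order.TTheory GRing.Theory Num.Theory.
Import numFieldNormedType.Exports.

Local Open Scope classical_set_scope.
Local Open Scope ring_scope.

Inductive scalar_kind := RealScalars | ComplexScalars.

Section Scalars.
Variables (R : realType) (k : scalar_kind).

Definition scalars : numFieldType :=
  match k with RealScalars => R : numFieldType | ComplexScalars => R[i]%C end.

(* In [R[i]] the norm is complex-valued; [modulus] is the same quantity
   in [R], where suprema are available. *)
Definition modulus : scalars -> R :=
  match k return match k with RealScalars => R : numFieldType
                            | ComplexScalars => R[i]%C end -> R with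
  | RealScalars => fun x => `|x|
  | ComplexScalars => fun z => complex.Re `|z|
  end.

Definition of_real : R -> scalars :=
  match k return R -> match k with RealScalars => R : numFieldType
                                 | ComplexScalars => R[i]%C end with
  | RealScalars => fun x => x
  | ComplexScalars => fun x => real_complex R x
  end.

Lemma of_real_modulus z : of_real (modulus z) = `|z|.
Proof.
by move: z; rewrite /of_real /modulus /scalars; case: k => //=.
Qed.

Lemma of_real_le x y : (of_real x <= of_real y) = (x <= y).
Proof. by rewrite /of_real /scalars; case: k => //=; rewrite lecR. Qed.

End Scalars.

HB.mixin Record NormedModule_isBanachAlgebra (K : numFieldType) A
    & CompleteNormedModule K A := {
  bmul : A -> A -> A ;
  bmulA : associative bmul ;
  bmulDl : left_distributive bmul +%R ;
  bmulDr : right_distributive bmul +%R ;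
  bmulZl : forall (c : K) (x y : A), bmul (c *: x) y = c *: bmul x y ;
  bmulZr : forall (c : K) (x y : A), bmul x (c *: y) = c *: bmul x y ;
  norm_bmul : forall x y : A, `|bmul x y| <= `|x| * `|y|
}.

(* No unit is required, hence not an [algType]. *)
#[short(type="banachAlgType")]
HB.structure Definition BanachAlgebra (K : numFieldType) :=
  {A of CompleteNormedModule K A & NormedModule_isBanachAlgebra K A}.

Section DualSpace.
Variables (K : numFieldType) (V : normedModType K).

Definition is_dual : {pred (V -> K^o)} :=
  fun f => `[< linear f /\ continuous f >].

Lemma is_dual_submod : submod_closed is_dual.
Proof.
split.
  apply/asboolP; split; first by move=> c x y; rewrite scaler0 addr0.
  exact: cst_continuous.
move=> c f g /asboolP[lf cf] /asboolP[lg cg]; apply/asboolP; split.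
  move=> d x y; rewrite /= !fctE lf lg.
  rewrite /= !scalerDr !scalerA [in c * d]mulrC -!addrA; congr (_ + _).
  by rewrite addrCA.
by move=> x; apply: cvgD; [apply: cvgZr; exact: cf | exact: cg].
Qed.

HB.instance Definition _ :=
  GRing.isSubmodClosed.Build K (V -> K^o) is_dual
    (GRing.submod_closed_semi is_dual_submod).

Record dual := Dual { dual_fun :> V -> K^o ; _ : dual_fun \in is_dual }.
HB.instance Definition _ := [isSub for dual_fun].
HB.instance Definition _ := [Choice of dual by <:].
HB.instance Definition _ := [SubChoice_isSubLmodule of dual by <:].

Lemma dual_linear (f : dual) : linear f.
Proof. by case: f => f /= /asboolP[]. Qed.

Lemma dual_continuous (f : dual) : continuous f.
Proof. by case: f => f /= /asboolP[]. Qed.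

HB.instance Definition _ (f : dual) :=
  GRing.isLinear.Build K V K^o *:%R f (dual_linear f).

Lemma dual_ext (f g : dual) : f =1 g -> f = g.
Proof. by move=> fg; apply/val_inj/funext. Qed.

Lemma dualDE (f g : dual) x : (f + g) x = f x + g x.
Proof. by []. Qed.

Lemma dualZE c (f : dual) x : (c *: f) x = c *: f x.
Proof. by []. Qed.

Lemma bounded_is_dual (f : V -> K^o) (M : K) : linear f ->
  (forall x, `|f x| <= M * `|x|) -> f \in is_dual.
Proof.
move=> lf fM; apply/asboolP; split=> //.
pose F := GRing.isLinear.Build K V K^o *:%R f lf.
pose G : {linear V -> K^o} := HB.pack f F.
suff : continuous G by [].
apply/linear_bounded_continuous/bounded_funP => r.
exists (`|M| * `|r|) => x xr; apply: (le_trans (fM x)).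
have [->|x0] := eqVneq x 0; first by rewrite normr0 mulr0 mulr_ge0.
have nx0 : 0 < `|x| by rewrite normr_gt0.
have M0 : 0 <= M by rewrite -(pmulr_lge0 _ nx0) (le_trans _ (fM x)).
have r0 : 0 <= r by rewrite (le_trans _ xr).
by rewrite (ger0_norm M0) (ger0_norm r0) ler_wpM2l.
Qed.

Lemma dual_bounded (f : dual) :
  exists2 M : K, 0 <= M & forall x, `|f x| <= M * `|x|.
Proof.
have /linear_boundedP[y [yr fy]] : bounded_near (f : V -> K^o) (nbhs (0 : V)).
  by apply/linear_bounded_continuous/dual_continuous.
exists (`|y| + 1) => [|x]; first by rewrite addr_ge0.
by apply: fy; rewrite (le_lt_trans (real_ler_norm yr))// ltrDl.
Qed.

Definition mk_dual (f : V -> K^o) (lf : linear f)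
  (bf : exists M : K, forall x, `|f x| <= M * `|x|) : dual :=
  Dual (let: ex_intro _ fM := bf in bounded_is_dual lf fM).

End DualSpace.

Section DualNorm.
Variables (R : realType) (k : scalar_kind).
Local Notation K := (scalars R k).
Variable V : normedModType K.
Implicit Types f g : dual V.

Definition dual_norm f : K :=
  of_real k (sup [set modulus (f x) | x in [set x : V | `|x| <= 1]]).

Lemma ge0_of_real (c : K) : 0 <= c -> c = of_real k (modulus c).
Proof. by move=> c0; rewrite of_real_modulus ger0_norm. Qed.

Let values_nonempty f :
  [set modulus (f x) | x in [set x : V | `|x| <= 1]] !=set0.
Proof. by exists (modulus (f 0)), 0; rewrite //= normr0 ler01. Qed.

Lemma dual_norm_lub f (M : K) : 0 <= M ->
  (forall x, `|x| <= 1 -> `|f x| <= M) -> dual_norm f <= M.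
Proof.
move=> M0 fM; rewrite (ge0_of_real M0) of_real_le; apply: ge_sup => //.
by move=> _ [x x1 <-]; rewrite -(of_real_le k) -(ge0_of_real M0) of_real_modulus fM.
Qed.

Lemma dual_norm_ub1 f x : `|x| <= 1 -> `|f x| <= dual_norm f.
Proof.
move=> x1; rewrite -of_real_modulus of_real_le; apply: ub_le_sup; last by exists x.
have [M M0 fM] := dual_bounded f; exists (modulus M) => _ [y /= y1 <-].
rewrite -(of_real_le k) -(ge0_of_real M0) of_real_modulus (le_trans (fM y))//.
by rewrite -[leRHS]mulr1 ler_wpM2l.
Qed.

Lemma dual_norm_ge0 f : 0 <= dual_norm f.
Proof. by apply: le_trans (dual_norm_ub1 f (x := 0) _); rewrite ?normr0. Qed.

Lemma le_dual_norm f x : `|f x| <= dual_norm f * `|x|.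
Proof.
have [->|x0] := eqVneq x 0; first by rewrite linear0 !normr0 mulr0.
have nx0 : 0 < `|x| by rewrite normr_gt0.
rewrite -ler_pdivrMr// mulrC.
have -> : `|x|^-1 * `|f x| = `|f (`|x|^-1 *: x)|.
  by rewrite linearZ normrZ normfV normr_id.
by apply: dual_norm_ub1; rewrite normrZ normfV normr_id mulVf ?gt_eqF.
Qed.

Let dual_normD f g : dual_norm (f + g) <= dual_norm f + dual_norm g.
Proof.
apply: dual_norm_lub => [|x x1]; first by rewrite addr_ge0 ?dual_norm_ge0.
by rewrite dualDE (le_trans (ler_normD _ _))// lerD ?dual_norm_ub1.
Qed.

Let dual_normZ_le (c : K) f : dual_norm (c *: f) <= `|c| * dual_norm f.
Proof.
apply: dual_norm_lub => [|x x1]; first by rewrite mulr_ge0 ?dual_norm_ge0.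
by rewrite dualZE normrZ ler_wpM2l ?dual_norm_ub1.
Qed.

Let dual_normZ (c : K) f : dual_norm (c *: f) = `|c| * dual_norm f.
Proof.
apply/eqP; rewrite eq_le dual_normZ_le /=.
have [->|c0] := eqVneq c 0; first by rewrite normr0 mul0r dual_norm_ge0.
have nc0 : 0 < `|c| by rewrite normr_gt0.
rewrite mulrC -ler_pdivlMr// mulrC -normfV.
by rewrite -[X in dual_norm X <= _](scalerK c0) dual_normZ_le.
Qed.

Let dual_norm0_eq0 f : dual_norm f = 0 -> f = 0.
Proof.
move=> f0; apply: dual_ext => x; apply/eqP; rewrite -normr_le0.
by have := le_dual_norm f x; rewrite f0 mul0r.
Qed.

HB.instance Definition _ := Lmodule_isNormed.Build K (dual V)
  dual_normD dual_normZ dual_norm0_eq0.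

Lemma dual_normE f : `|f| = dual_norm f.
Proof. by []. Qed.

End DualNorm.

Section WeakTopologies.
Variables (R : realType) (k : scalar_kind) (V : normedModType (scalars R k)).

(* sigma(V^*, V): a net of functionals converges iff it does so pointwise on V *)
Definition weak_star_topology : topologicalType :=
  initial_topology
    (fun (f : dual V) => (fun x : V => f x) : {ptws V -> (scalars R k)^o}).

(* sigma(V, V^* ) *)
Definition weak_topology : topologicalType :=
  initial_topology
    (fun (x : V) => (fun f : dual V => f x) : {ptws dual V -> (scalars R k)^o}).

End WeakTopologies.

Section BidualEmbedding.
Variables (R : realType) (k : scalar_kind) (V : normedModType (scalars R k)).

Fact bidual_embedding_linear (x : V) :
  linear (fun f : dual V => f x : (scalars R k)^o).
Proof. by []. Qed.

Fact bidual_embedding_bounded (x : V) :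
  exists M : scalars R k, forall f : dual V, `|f x| <= M * `|f|.
Proof. by exists `|x| => f; rewrite mulrC le_dual_norm. Qed.

Definition bidual_embedding (x : V) : dual (dual V) :=
  mk_dual (bidual_embedding_linear x) (bidual_embedding_bounded x).

End BidualEmbedding.

Section Arens.
Variables (R : realType) (k : scalar_kind) (A : banachAlgType (scalars R k)).
Local Notation K := (scalars R k).

Local Notation A1 := (dual A).
Local Notation A2 := (dual A1).
Local Notation A3 := (dual A2).

Fact dual_act_linear (a' : A1) (a : A) : linear (fun b => a' (bmul a b) : K^o).
Proof. by move=> c x y; rewrite bmulDr bmulZr linearP. Qed.

Fact dual_act_le (a' : A1) (a b : A) :
  `|a' (bmul a b)| <= (`|a'| * `|a|) * `|b|.
Proof.
rewrite (le_trans (le_dual_norm _ _))// -mulrA.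
by rewrite ler_wpM2l ?norm_bmul ?dual_norm_ge0.
Qed.

(* a'a *)
Definition dual_act (a' : A1) (a : A) : A1 :=
  mk_dual (dual_act_linear a' a) (ex_intro _ _ (dual_act_le a' a)).

Fact norm_dual_act (a' : A1) (a : A) : `|dual_act a' a| <= `|a'| * `|a|.
Proof.
apply: dual_norm_lub => [|x x1]; first exact: mulr_ge0.
rewrite (le_trans (dual_act_le _ _ _))//.
by rewrite -[leRHS]mulr1 ler_wpM2l// mulr_ge0.
Qed.

Fact bidual_act_linear (a'' : A2) (a' : A1) :
  linear (fun a => a'' (dual_act a' a) : K^o).
Proof.
move=> c x y; rewrite -linearP; congr (a'' _); apply: dual_ext => b /=.
by rewrite bmulDl bmulZl linearP.
Qed.

Fact bidual_act_le (a'' : A2) (a' : A1) (a : A) :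
  `|a'' (dual_act a' a)| <= (`|a''| * `|a'|) * `|a|.
Proof.
rewrite (le_trans (le_dual_norm _ _))// -mulrA.
by rewrite ler_wpM2l ?norm_dual_act ?dual_norm_ge0.
Qed.

(* a''a' *)
Definition bidual_act (a'' : A2) (a' : A1) : A1 :=
  mk_dual (bidual_act_linear a'' a') (ex_intro _ _ (bidual_act_le a'' a')).

Fact norm_bidual_act (a'' : A2) (a' : A1) :
  `|bidual_act a'' a'| <= `|a''| * `|a'|.
Proof.
apply: dual_norm_lub => [|x x1]; first exact: mulr_ge0.
rewrite (le_trans (bidual_act_le _ _ _))//.
by rewrite -[leRHS]mulr1 ler_wpM2l// mulr_ge0.
Qed.

Fact arens_linear (a'' b'' : A2) :
  linear (fun a' => a'' (bidual_act b'' a') : K^o).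
Proof.
move=> c x y; rewrite -linearP; congr (a'' _); apply: dual_ext => b.
rewrite dualDE dualZE /= -linearP; congr (b'' _).
by apply: dual_ext.
Qed.

Fact arens_le (a'' b'' : A2) (a' : A1) :
  `|a'' (bidual_act b'' a')| <= (`|a''| * `|b''|) * `|a'|.
Proof.
rewrite (le_trans (le_dual_norm _ _))// -mulrA.
by rewrite ler_wpM2l ?norm_bidual_act ?dual_norm_ge0.
Qed.

(* first Arens product a''b'' *)
Definition arens (a'' b'' : A2) : A2 :=
  mk_dual (arens_linear a'' b'') (ex_intro _ _ (arens_le a'' b'')).

Fact norm_arens (a'' b'' : A2) : `|arens a'' b''| <= `|a''| * `|b''|.
Proof.
apply: dual_norm_lub => [|x x1]; first exact: mulr_ge0.
rewrite (le_trans (arens_le _ _ _))//.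
by rewrite -[leRHS]mulr1 ler_wpM2l// mulr_ge0.
Qed.

Fact tridual_ract_linear (a''' : A3) (b'' : A2) :
  linear (fun c'' => a''' (arens b'' c'') : K^o).
Proof.
move=> c x y; rewrite -linearP; congr (a''' _); apply: dual_ext => a'.
rewrite dualDE dualZE /= -linearP; congr (b'' _).
by apply: dual_ext.
Qed.

Fact tridual_ract_bounded (a''' : A3) (b'' : A2) :
  exists M : K, forall c'', `|a''' (arens b'' c'')| <= M * `|c''|.
Proof.
exists (`|a'''| * `|b''|) => c''; rewrite (le_trans (le_dual_norm _ _))//.
by rewrite -mulrA ler_wpM2l ?norm_arens ?dual_norm_ge0.
Qed.

(* a'''b'' *)
Definition tridual_ract (a''' : A3) (b'' : A2) : A3 :=
  mk_dual (tridual_ract_linear a''' b'') (tridual_ract_bounded a''' b'').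

Fact tridual_lact_linear (b'' : A2) (a''' : A3) :
  linear (fun c'' => a''' (arens c'' b'') : K^o).
Proof. by move=> c x y; rewrite -linearP; congr (a''' _); apply: dual_ext. Qed.

Fact tridual_lact_bounded (b'' : A2) (a''' : A3) :
  exists M : K, forall c'', `|a''' (arens c'' b'')| <= M * `|c''|.
Proof.
exists (`|a'''| * `|b''|) => c''; rewrite (le_trans (le_dual_norm _ _))//.
by rewrite -mulrA ler_wpM2l ?dual_norm_ge0// mulrC norm_arens.
Qed.

(* b''a''' *)
Definition tridual_lact (b'' : A2) (a''' : A3) : A3 :=
  mk_dual (tridual_lact_linear b'' a''') (tridual_lact_bounded b'' a''').

(* [weak_star_topology A1] is sigma(A^**, A^* ) and [weak_topology A2] is
   sigma(A^**, A^*** ), both carried by [A2]. *)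
Definition Z1 : set A2 :=
  [set a'' | continuous (fun b'' : weak_star_topology A1 =>
                           arens a'' b'' : weak_star_topology A1)].

Definition Z1_tilde_l : set A2 :=
  [set a'' | continuous (fun b'' : weak_star_topology A1 =>
                           arens a'' b'' : weak_topology A2)].

Definition Z1_tilde_r : set A2 :=
  [set a'' | continuous (fun b'' : weak_star_topology A1 =>
                           arens b'' a'' : weak_topology A2)].

End Arens.

Arguments Z1 {R k} A.
Arguments Z1_tilde_l {R k} A.
Arguments Z1_tilde_r {R k} A.

(* Main.v *)
Require Import Defs.
From mathcomp Require Import all_boot all_order all_algebra.
From mathcomp Require Import all_classical all_reals all_analysis.

Local Open Scope classical_set_scope.

(** The weak topology of [A^**] is initial, so a map into it is continuous as
    soon as its composite with every [a'''] in [A^***] is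
    ([weak_continuous]).  For left multiplication by [a''] that composite is
    [b'' |-> <a''', a'' b''> = <a''' a'', b''>], which is the functional
    [a''' a''] itself; for right multiplication it is [a'' a'''].  The
    hypothesis of each part says that this functional is evaluation at an
    element of [A^*], hence weak*-continuous ([range_embedding_continuous]).
    Since [A^*] embeds in [A^***], the weak topology refines the weak* one and
    [Z1_tilde_l A] is always contained in [Z1 A] ([Z1_tilde_l_sub]); so once
    the former is all of [A^**], the latter is too. *)

(** The pointwise topology is the supremum of the initial topologies of the
    evaluations, so continuity can be tested one evaluation at a time. *)
Lemma continuous_ptws (T : topologicalType) (I : Type) (U : topologicalType)
    (g : T -> {ptws I -> U}) :
  (forall i, continuous (fun t => g t i)) -> continuous g.
Proof.
move=> cg t; apply/cvg_sup => i.
by apply: (@continuous_comp_initial _ _ _ (fun f : I -> U => f i)); exact: cg.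
Qed.

Section Continuity.
Context {R : realType} {k : scalar_kind}.
Local Notation K := (scalars R k).

Section Normed.
Context {V : normedModType K}.

Lemma weak_star_eval_continuous (x : V) :
  continuous (fun f : weak_star_topology V => (f : dual V) x : K^o).
Proof.
pose ev (f : dual V) : {ptws V -> K^o} := fun x => f x.
move=> f; apply: (@continuous_comp _ _ _
  (ev : weak_star_topology V -> _) (fun h : {ptws V -> K^o} => h x)).
  exact: (@initial_continuous _ _ ev f).
exact: (@proj_continuous V (fun=> K^o) x).
Qed.

Lemma weak_eval_continuous (f : dual V) :
  continuous (fun x : weak_topology V => f (x : V) : K^o).
Proof.
pose ev (x : V) : {ptws dual V -> K^o} := fun f => f x.
move=> x; apply: (@continuous_comp _ _ _
  (ev : weak_topology V -> _) (fun h : {ptws dual V -> K^o} => h f)).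
  exact: (@initial_continuous _ _ ev x).
exact: (@proj_continuous (dual V) (fun=> K^o) f).
Qed.

Lemma weak_star_continuous {T : topologicalType}
    (g : T -> weak_star_topology V) :
  (forall x : V, continuous (fun t => (g t : dual V) x : K^o)) -> continuous g.
Proof.
by move=> cg; apply: continuous_comp_initial; apply: continuous_ptws.
Qed.

Lemma weak_continuous {T : topologicalType} (g : T -> weak_topology V) :
  (forall f : dual V, continuous (fun t => f (g t : V) : K^o)) -> continuous g.
Proof.
by move=> cg; apply: continuous_comp_initial; apply: continuous_ptws.
Qed.

Lemma range_embedding_continuous (F : dual (dual V)) :
  range (@bidual_embedding R k V) F ->
  continuous (fun f : weak_star_topology V => F (f : dual V) : K^o).
Proof. by case=> x _ <-; exact: weak_star_eval_continuous. Qed.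

End Normed.

Context {A : banachAlgType K}.

(** Evaluation at [a'] in [A^*] is a member of [A^***], so it remains
    continuous for the weak topology of [A^**]. *)
Lemma Z1_tilde_l_sub : Z1_tilde_l A `<=` Z1 A.
Proof.
move=> a ca; apply: weak_star_continuous => a' b.
apply: (@continuous_comp _ _ _
  (arens a : weak_star_topology (dual A) -> weak_topology (dual (dual A)))
  (bidual_embedding a' : weak_topology (dual (dual A)) -> K^o)).
  exact: ca.
exact: weak_eval_continuous.
Qed.

End Continuity.

Theorem mainTheorem1 (R : realType) (k : scalar_kind)
    (A : banachAlgType (scalars R k)) :
  ([set tridual_ract a''' b'' | a''' in [set: dual (dual (dual A))]
                              & b'' in [set: dual (dual A)]]
     `<=` range (@bidual_embedding R k (dual A)) ->
   Z1_tilde_l A = Z1 A /\ Z1 A = [set: dual (dual A)])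
  /\
  ([set tridual_lact b'' a''' | b'' in [set: dual (dual A)]
                              & a''' in [set: dual (dual (dual A))]]
     `<=` range (@bidual_embedding R k (dual A)) ->
   Z1_tilde_r A = [set: dual (dual A)]).
Proof.
split=> AA.
  have Zl : Z1_tilde_l A = [set: dual (dual A)].
    apply/seteqP; split=> // a'' _; apply: weak_continuous => a'''.
    (* The composite with [a'''] is convertible to the functional [a''' a'']. *)
    apply: (@range_embedding_continuous _ _ _ (tridual_ract a''' a'')).
    by apply: AA; exists a''' => //; exists a''.
  have Z : Z1 A = [set: dual (dual A)].
    by apply/seteqP; split=> //; rewrite -Zl; exact: Z1_tilde_l_sub.
  by rewrite Zl Z.
apply/seteqP; split=> // a'' _; apply: weak_continuous => a'''.
apply: (@range_embedding_continuous _ _ _ (tridual_lact a'' a''')).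
by apply: AA; exists a'' => //; exists a'''.
Qed.
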